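(* Let $N\ge 2$ be an integer and $m\in\mathbb{Z}$. Then \[ \langle W_m\rangle^{{\rm SU}(N)_{-N}}(q)=\begin{cases}(-1)^{\ell(N-1)}q^{(N-1)\ell(\ell-1)/2}\dfrac{1-q^{\ell N}}{1-q^{\ell}}, & m=\ell N \text{ with } \ell\in\mathbb{Z},\\[2mm] 0, & m\not\equiv 0 \pmod N,\end{cases} \] where for $\ell=0$ the quotient $\frac{1-q^{\ell N}}{1-q^{\ell}}$ is understood as $1+q^{\ell}+\dots+q^{(N-1)\ell}=N$.
   Context: Let $|q|<1$ and write $(a;q)_\infty=\prod_{k\ge0}(1-aq^k)$. Let $s_1,\dots,s_{N-1}$ be variables and put $s_N:=(s_1\cdots s_{N-1})^{-1}$. Define \[ \langle W_m\rangle^{{\rm SU}(N)_{-N}}(q):=\frac{(q;q)_\infty^{N-1}}{N!}\oint\prod_{i=1}^{N-1}\frac{ds_i}{2\pi i s_i}\prod_{\substack{i,j=1\\ i\ne j}}^N(s_is_j^{-1};q)_\infty\sum_{i=1}^N s_i^m, \] where the integral denotes the constant term in $s_1,\dots,s_{N-1}$ of the integrand expanded as a formal Laurent series in the $s_i$ (coefficientwise a power series in $q$), equivalently the contour integral over the unit circles. *)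

(* Defs.v *)
From mathcomp Require Import all_boot all_order all_algebra.
Set Implicit Arguments. Unset Strict Implicit. Unset Printing Implicit Defensive.
Import Order.TTheory GRing.Theory Num.Theory.
Local Open Scope ring_scope.

(* Formal Laurent monomials in s_1..s_k (exponent vectors), times q^d.
   A "term" is (coefficient, exponent vector in s, exponent of q);
   a polynomial is a finite list of terms (sum of the terms). *)
Definition mono (k : nat) := {ffun 'I_k -> int}.
Definition term (k : nat) := (rat * mono k * nat)%type.
Definition poly_s (k : nat) := seq (term k).

Definition mono0 k : mono k := [ffun => 0].

Definition tmul k (a b : term k) : term k :=
  (a.1.1 * b.1.1, [ffun i => a.1.2 i + b.1.2 i], (a.2 + b.2)%N).
Definition pmul k (p r : poly_s k) : poly_s k :=
  [seq tmul a b | a <- p, b <- r].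
Definition pone k : poly_s k := [:: (1, mono0 k, 0%N)].
Definition pprod k (ps : seq (poly_s k)) : poly_s k := foldr (@pmul k) (pone k) ps.

(* exponent vector of s_i (i : 'I_N, i.e. s_{i+1}) in the variables
   s_1..s_{N-1}; the last one is s_N = (s_1 ... s_{N-1})^{-1}. *)
Definition expo N (i : 'I_N) : mono N.-1 :=
  [ffun j : 'I_N.-1 => if (i < N.-1)%N
                       then (if nat_of_ord j == nat_of_ord i then 1 else 0)
                       else -1].

Definition qfac k (x : mono k) (d : nat) : poly_s k :=
  [:: (1, mono0 k, 0%N); (-1, x, d)].

(* Truncation at order M of the integrand
   (q;q)^{N-1} * prod_{i<>j} (s_i/s_j; q) * sum_i s_i^m :
   (q;q) is truncated to prod_{k=1}^M (1-q^k), (x;q) to prod_{k=0}^M (1-x q^k).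
   All coefficients of q^n with n <= M are exact. *)
Definition integrand_trunc (N : nat) (m : int) (M : nat) : poly_s N.-1 :=
  pprod (nseq N.-1 (pprod [seq qfac (mono0 N.-1) k | k <- iota 1 M])
     ++ flatten [seq [seq qfac [ffun t => expo i t - expo j t] k | k <- iota 0 M.+1]
                  | i <- enum 'I_N, j <- [seq j <- enum 'I_N | j != i]]
     ++ [:: [seq (1, [ffun t => expo i t * m], 0%N) | i <- enum 'I_N]]).

Definition wilson_coef (N : nat) (m : int) (M n : nat) : rat :=
  (N`!%:R)^-1 * \sum_(t <- integrand_trunc N m M | (t.1.2 == mono0 N.-1) && (t.2 == n)) t.1.1.

(* coefficient of q^n of the right-hand side.  For m = l N the RHS is
   (-1)^{l(N-1)} q^{(N-1) l (l-1)/2} (1 + q^l + ... + q^{(N-1) l}),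
   which is the quotient (1-q^{lN})/(1-q^l) written as a geometric sum
   (valid for every integer l, and the paper's convention for l = 0). *)
Definition rhs_coef (N : nat) (m : int) (n : nat) : rat :=
  if (N%:Z %| m)%Z then
    let l := (m %/ N%:Z)%Z in
    let e := ((N.-1)%:Z * ((l * (l - 1)) %/ 2)%Z) in
    (-1 : rat) ^ (l * (N.-1)%:Z) *
      \sum_(j < N) ((e + l * (nat_of_ord j)%:Z == n%:Z) : nat)%:R
  else 0.

(* Main.v *)
From mathcomp Require Import all_boot all_fingroup all_order all_algebra.
From mathcomp Require Import mpoly zify ring.
Require Import Defs.

(** Treat [s_1, .., s_N] as independent variables: the integrand is homogeneous of
    degree [m], and its constant term under [s_1 .. s_N = 1] is the coefficient of
    [(s_1 .. s_N)^l] if [m = l N], and vanishes if [N] does not divide [m].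

    The product over all [i <> j] is the q-Dyson product
    [A = prod_(i<j) (s_i/s_j;q)(q s_j/s_i;q)], which is antisymmetric up to a monomial,
    times a Vandermonde product.  Expanding the latter and using antisymmetry, the
    factor [1/N!] disappears and one is left with the constant terms of
    [A s_i^m (s_1 .. s_N)^(-l)], one for each [i].  The substitution
    [s_i -> q^l s_i] changes each of the factors of [A] containing [s_i] by a monomial,
    so such a constant term is [(-1)^(l(N-1)) q^e] times the constant term of [A], and the
    [N] values of [e] are those of the geometric sum.

    Finally, [(q;q)^(N-1) A] has constant term 1: truncating [A] to [K] factors per
    pair gives the equal-parameter q-Dyson constant term [(q;q)_(NK) / (q;q)_K^N],
    proved by the argument of Karasev and Petrov.  Infinite products never
    occur, as everything is computed modulo [q^(M+1)] with large finite parameters. *)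

Set Implicit Arguments. Unset Strict Implicit. Unset Printing Implicit Defensive.
Import Order.TTheory GRing.Theory Num.Theory.
Local Open Scope ring_scope.

(* With [x = x_i] and [y = x_j], this is the q-Dyson factor
   [(x/y;q)_a (q y/x;q)_b] multiplied by [y^a x^b]. *)
Definition dyson_pair (S : comNzRingType) (q : S) (a b : nat) (x y : S) : S :=
  (\prod_(k < a) (y - q ^+ k * x)) * \prod_(k < b) (x - q ^+ k.+1 * y).

Definition dyson (S : comNzRingType) (q : S) (N : nat) (a b : 'I_N -> 'I_N -> nat)
    (x : 'I_N -> S) : S :=
  \prod_(i < N) \prod_(j < N | (i < j)%N) dyson_pair q (a i j) (b i j) (x i) (x j).

(** This is $(q;q)_n$. *)
Definition qfact (S : comNzRingType) (q : S) (n : nat) : S :=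
  \prod_(k < n) (1 - q ^+ k.+1).

Lemma rmorph_dyson (S T : comNzRingType) (f : {rmorphism S -> T}) (q : S) N a b
    (x : 'I_N -> S) :
  f (dyson q a b x) = dyson (f q) a b (fun i => f (x i)).
Proof.
rewrite rmorph_prod; apply: eq_bigr => i _; rewrite rmorph_prod; apply: eq_bigr => j _.
rewrite rmorphM !rmorph_prod /dyson_pair; congr (_ * _); apply: eq_bigr => k _;
by rewrite rmorphB rmorphM rmorphXn.
Qed.

Lemma eq_dyson (S : comNzRingType) (q : S) N (a b a' b' : 'I_N -> 'I_N -> nat)
    (x x' : 'I_N -> S) :
  a =2 a' -> b =2 b' -> x =1 x' -> dyson q a b x = dyson q a' b' x'.
Proof.
move=> ea eb ex; apply: eq_bigr => i _; apply: eq_bigr => j _.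
by rewrite ea eb !ex.
Qed.

Lemma rmorph_qfact (S T : comNzRingType) (f : {rmorphism S -> T}) (q : S) n :
  f (qfact q n) = qfact (f q) n.
Proof.
by rewrite rmorph_prod; apply: eq_bigr => k _; rewrite rmorphB rmorph1 rmorphXn.
Qed.

(** Links the pairs [i < j] of [dyson] with all ordered pairs of distinct indices, over which
    permuting the variables is a mere reindexing. *)
Lemma big_ltn_gtn (T : Type) (idx : T) (op : Monoid.com_law idx) (N : nat)
    (F : 'I_N -> 'I_N -> T) :
  \big[op/idx]_(i < N) \big[op/idx]_(j < N | (i < j)%N) op (F i j) (F j i) =
  \big[op/idx]_(i < N) \big[op/idx]_(j < N | j != i) F i j.
Proof.
under eq_bigr => i _ do rewrite big_split /=.
rewrite big_split /= [X in op _ X](exchange_big_dep xpredT) //= -big_split /=.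
apply: eq_bigr => i _; rewrite [RHS](bigID (fun j : 'I_N => (i < j)%N)) /=.
by congr (op _ _); apply: eq_bigl => j; rewrite -val_eqE /=; case: ltngtP.
Qed.

(** * Lagrange interpolation and coefficient extraction on a grid *)

(** Interpolating ['X^b] at the [d + 1] nodes returns ['X^b] itself because [b <= d]; the identity
    compares coefficients of degree [d]. *)
Lemma lagrange_lead_coef (F : fieldType) (d b : nat) (c : nat -> F) :
  {in [pred k | (k <= d)%N] &, injective c} -> (b <= d)%N ->
  \sum_(k < d.+1) c k ^+ b / \prod_(j < d.+1 | j != k) (c k - c j) = (b == d)%:R.
Proof.
move=> injc le_bd.
pose D (k : 'I_d.+1) := \prod_(j < d.+1 | j != k) (c k - c j).
pose L (k : 'I_d.+1) := \prod_(j < d.+1 | j != k) ('X - (c j)%:P).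
have sizeL k : size (L k) = d.+1.
  by rewrite /L (eq_bigl (fun j => j \in predC1 k)) // -big_enum size_prod_XsubC -cardE cardC1 card_ord.
have monL k : L k \is monic by apply: monic_prod => j _; exact: monicXsubC.
have D0 k : D k != 0.
  apply/prodf_neq0 => j jk; rewrite subr_eq0; apply: contra jk => /eqP /injc e.
  by apply/eqP/val_inj/esym/e; rewrite inE -ltnS.
pose P := \sum_(k < d.+1) (c k ^+ b / D k) *: L k - 'X^b.
have P0 : P = 0.
  apply: (@roots_geq_poly_eq0 _ _ [seq c (val k) | k <- enum 'I_d.+1]).
  - apply/allP => _ /mapP[k _ ->]; rewrite /root /P !hornerE horner_sum.
    rewrite (bigD1 k) //= big1 ?addr0 => [|j jk].
      rewrite hornerZ /L horner_prod.
      under [X in _ * X]eq_bigr do rewrite hornerXsubC.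
      by rewrite -/(D k) divfK // subrr.
    rewrite hornerZ /L horner_prod (bigD1 k) /=; last by rewrite eq_sym.
    by rewrite hornerXsubC subrr mul0r mulr0.
  - suff injk : injective (fun k : 'I_d.+1 => c (val k)).
      by rewrite (map_inj_uniq injk); exact: enum_uniq.
    by move=> i j e; apply: val_inj; apply: injc e; rewrite inE -ltnS ltn_ord.
  - rewrite size_map size_enum_ord; apply: leq_trans (size_polyD _ _) _.
    rewrite geq_max size_polyN size_polyXn ltnS le_bd andbT.
    apply: leq_trans (size_sum _ _ _) _; apply/bigmax_leqP => k _.
    by apply: leq_trans (size_scale_leq _ _) _; rewrite sizeL.
have := congr1 (fun p : {poly F} => p`_d) P0.
rewrite coef0 coefB coefXn coef_sum => /eqP; rewrite subr_eq0 => /eqP e.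
rewrite [b == d]eq_sym -e.
apply: eq_bigr => k _; rewrite coefZ.
by have := monL k; rewrite monicE lead_coefE sizeL => /eqP ->; rewrite mulr1.
Qed.

(* The coefficient formula behind the combinatorial Nullstellensatz. *)
Lemma mcoeff_grid (F : fieldType) (N d : nat) (c : nat -> F) (P : {mpoly F[N]}) :
  {in [pred k | (k <= d)%N] &, injective c} ->
  {in msupp P, forall m, mdeg m = (N * d)%N} ->
  P@_[multinom d | i < N] =
  \sum_(f : {ffun 'I_N -> 'I_d.+1}) P.@[fun i => c (f i)] /
     \prod_i \prod_(j < d.+1 | j != f i) (c (f i) - c j).
Proof.
move=> injc degP.
under eq_bigr => f _ do rewrite mevalE mulr_suml.
rewrite exchange_big /=.
(* For a single monomial the sum over the grid factors into one-variable Lagrange sums. *)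
have main m : mdeg m = (N * d)%N ->
    \sum_(f : {ffun 'I_N -> 'I_d.+1}) P@_m * \prod_i c (f i) ^+ m i /
     \prod_i \prod_(j < d.+1 | j != f i) (c (f i) - c j)
   = P@_m * (m == [multinom d | i < N])%:R.
  move=> dm; under eq_bigr => f _ do rewrite -mulrA -prodf_div.
  rewrite -mulr_sumr; congr (_ * _).
  rewrite -(bigA_distr_bigA (fun (i : 'I_N) (k : 'I_d.+1) => c k ^+ m i /
     \prod_(j < d.+1 | j != k) (c k - c j))) /=.
  have [->|neq] := eqVneq.
    by rewrite big1 // => i _; rewrite mnmE lagrange_lead_coef ?eqxx.
  (* A nonconstant exponent vector of total degree [N * d] has an entry below [d], and the factor of
     that entry vanishes. *)
  have [i lt_i] : exists i, (m i < d)%N.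
    apply/existsP; apply: contraNT neq => /existsPn H.
    have ge i : (d <= m i)%N by rewrite leqNgt.
    have : (\sum_i (m i - d) = 0)%N.
      rewrite sumnB => [|i _]; last exact: ge.
      by rewrite -mdegE dm sum_nat_const card_ord subnn.
    move/eqP; rewrite sum_nat_eq0 => /forallP H0.
    apply/eqP/mnmP => i; rewrite mnmE; apply/eqP; rewrite eqn_leq ge andbT.
    by rewrite -subn_eq0; exact: H0.
  rewrite (bigD1 i) //= lagrange_lead_coef ?(ltnW lt_i) //.
  by rewrite (ltn_eqF lt_i) mul0r.
rewrite big_seq (eq_bigr _ (fun m mP => main m (degP m mP))) -big_seq.
have [mP|mP] := boolP ([multinom d | i < N] \in msupp P).
  rewrite (bigD1_seq _ mP) ?msupp_uniq //= eqxx mulr1 big1 ?addr0 // => m /negPf ->.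
  by rewrite mulr0.
rewrite memN_msupp_eq0 // big_seq big1 // => m mP'.
case: eqP => [e|_]; last by rewrite mulr0.
by rewrite -e mP' in mP.
Qed.

(** * The equal-parameter q-Dyson constant term *)

(* A chain whose total length leaves no slack can have no descents. *)
Lemma tight_path (N K : nat) (al : 'I_N -> nat) (x : 'I_N) p : (0 < K)%N ->
  path (fun i j : 'I_N => al i + K + (j < i) <= al j)%N x p ->
  (al (last x p) <= al x + K * size p)%N ->
  path (fun i j : 'I_N => (i < j) && (al j == al i + K))%N x p.
Proof.
move=> K0; elim: p x => //= y p IHp x /andP[exy pathp] le.
have ge z r : path (fun i j : 'I_N => al i + K + (j < i) <= al j)%N z r ->
    (al z + K * size r <= al (last z r))%N.
  elim: r z => [|t r IHr] z /=; first by lia.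
  by case/andP => ? /IHr; lia.
have := ge _ _ pathp; rewrite mulnS in le => gep.
rewrite IHp ?andbT //; last by lia.
have [lt|lt|/val_inj e] := ltngtP x y; last by subst; lia.
- by apply/eqP; lia.
- by rewrite lt in exy; lia.
Qed.

(** Sort the indices by [al]: consecutive values differ by at least [K], and by more at a descent of
    the indices, while all values lie in a range of length [n * K]. There is no slack, so the order
    is the natural one, every gap is [K], and the first value is 0. *)
Lemma dyson_point (n K : nat) (al : 'I_n.+1 -> nat) : (0 < K)%N ->
  (forall i, al i <= n * K)%N ->
  (forall i j : 'I_n.+1, (i < j)%N -> (al i + K <= al j) || (al j + K < al i))%N ->
  forall i, al i = (i * K)%N.
Proof.
move=> K0 le_al sep.
pose s := sort (relpre al leq) (enum 'I_n.+1).
have e_of (i j : 'I_n.+1) : i != j -> (al i <= al j)%N -> (al i + K + (j < i) <= al j)%N.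
  by case: (ltngtP i j) => [/sep|/sep|/val_inj ->]; rewrite ?eqxx //; lia.
have perm_s : perm_eq s (enum 'I_n.+1) by rewrite perm_sort.
have uniq_s : uniq s by rewrite (perm_uniq perm_s) enum_uniq.
have size_s : size s = n.+1 by rewrite size_sort size_enum_ord.
have sorted_s : sorted (relpre al leq) s.
  by apply: sort_sorted => i j /=; exact: leq_total.
case def_s : s uniq_s size_s sorted_s => [//|x p] uniq_s [size_p] /= sorted_s.
have e_s : path (fun i j : 'I_n.+1 => al i + K + (j < i) <= al j)%N x p.
  elim: p x {def_s size_p} uniq_s sorted_s => //= y p IHp x.
  rewrite inE negb_or -!andbA => /and4P[xy _ yp up] /andP[le pp].
  by rewrite e_of // IHp //= yp.
have {e_s} tight : path (fun i j : 'I_n.+1 => (i < j) && (al j == al i + K))%N x p.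
  apply: tight_path => //; rewrite size_p mulnC.
  by apply: leq_trans (le_al _) _; rewrite leq_addl.
have eq_s : s = enum 'I_n.+1.
  apply: (@irr_sorted_eq _ (fun i j : 'I_n.+1 => (i < j)%N)).
  - by move=> i j k; exact: ltn_trans.
  - by move=> i; exact: ltnn.
  - by rewrite def_s /=; apply: sub_path tight => i j /andP[].
  - have := iota_ltn_sorted 0 n.+1.
    by rewrite -val_enum_ord sorted_map.
  - exact: perm_mem.
have al_nth : forall k, (k < n.+1)%N -> al (nth ord0 s k) = (al x + k * K)%N.
  elim=> [_|k IHk lt_k]; first by rewrite def_s mul0n addn0.
  have /(pathP ord0) /(_ k) := tight; rewrite size_p => /(_ lt_k) /andP[_ /eqP].
  rewrite -def_s -[nth ord0 p k]/(nth ord0 (x :: p) k.+1) -def_s => ->.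
  by rewrite IHk 1?ltnW // mulSn; lia.
have x0 : al x = 0%N.
  by have := al_nth n (ltnSn n); have := le_al (nth ord0 s n); lia.
move=> i; have := al_nth i (ltn_ord i).
by rewrite x0 eq_s nth_ord_enum.
Qed.

Lemma prod_nat_blocks (S : comNzRingType) (f : nat -> S) (K m n : nat) : (m <= n)%N ->
  \prod_(m <= j < n) \prod_(0 <= k < K) f (j * K + k)%N =
  \prod_(m * K <= t < n * K) f t.
Proof.
elim: n => [|n IHn]; first by rewrite leqn0 => /eqP ->; rewrite !big_geq.
rewrite leq_eqVlt => /predU1P[->|le_mn]; first by rewrite !big_geq.
rewrite big_nat_recr //= IHn //.
rewrite [RHS](@big_cat_nat _ _ _ (n * K)%N) /= ?leq_mul2r ?leqnSn ?orbT //; last first.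
  by rewrite -ltnS le_mn orbT.
congr (_ * _); rewrite -{2}[(n * K)%N]add0n big_addn mulSn addnK.
by apply: eq_bigr => k _; rewrite addnC.
Qed.

Lemma prod_geom_shift (S : comNzRingType) (q : S) (a c r : nat) :
  \prod_(a + c <= t < a + (c + r)) (q ^+ a - q ^+ t.+1) =
  q ^+ (a * r) * \prod_(c <= t < c + r) (1 - q ^+ t.+1).
Proof.
have -> : q ^+ (a * r) = \prod_(c <= t < c + r) q ^+ a.
  by rewrite prodr_const_nat addKn exprM.
rewrite -big_split /= [(a + c)%N]addnC big_addn addKn; apply: eq_bigr => t _.
by rewrite mulrBr mulr1 -exprD addnS addnC.
Qed.

(** Compares the value at the surviving grid point with the denominator in [mcoeff_grid]. The part
    [lo] is common to both; [up] and [hi] differ by a ratio of q-factorials, and the blocks [X]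
    multiply up to [qfact q (n.+1 * K)]. *)
Lemma dyson_geom (S : comNzRingType) (q : S) (n K : nat) :
  dyson q (fun _ _ => K) (fun _ _ => K) (fun i : 'I_n.+1 => q ^+ (i * K))
    * qfact q K ^+ n.+1 =
  qfact q (n.+1 * K) *
  \prod_(i < n.+1) \prod_(j < (n * K).+1 | j != (i * K)%N :> nat) (q ^+ (i * K) - q ^+ j).
Proof.
pose lo i := \prod_(0 <= t < i * K) (q ^+ (i * K) - q ^+ t).
pose hi i := \prod_(i * K <= t < n * K) (q ^+ (i * K) - q ^+ t.+1).
pose up i := \prod_(i.+1 * K <= t < n.+1 * K) (q ^+ (i * K) - q ^+ t.+1).
pose X i := \prod_(i * K <= t < i.+1 * K) (1 - q ^+ t.+1).
have qfactX m : qfact q (m.+1 * K) = qfact q (m * K) * X m.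
  rewrite /qfact -!(big_mkord xpredT (fun t => 1 - q ^+ t.+1)).
  by rewrite (@big_cat_nat _ _ _ (m * K)%N) //= leq_mul2r leqnSn orbT.
have def_grid (i : 'I_n.+1) :
    \prod_(j < (n * K).+1 | j != (i * K)%N :> nat) (q ^+ (i * K) - q ^+ j) = lo i * hi i.
  have le : (i * K <= n * K)%N by rewrite leq_mul2r -ltnS ltn_ord orbT.
  rewrite -(big_mkord (fun j => j != i * K)%N (fun j => q ^+ (i * K) - q ^+ j)).
  rewrite (@big_cat_nat _ _ _ (i * K)%N) ?(leqW le) //=; congr (_ * _).
    by apply: congr_big_nat => // t /andP[_ lt]; rewrite ltn_eqF.
  rewrite big_ltn_cond ?ltnS // eqxx /= big_add1 /=.
  by apply: congr_big_nat => // t /andP[lt _]; rewrite gtn_eqF.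
have def_dyson : dyson q (fun _ _ => K) (fun _ _ => K) (fun i : 'I_n.+1 => q ^+ (i * K))
    = \prod_(i < n.+1) (lo i * up i).
  rewrite /dyson; under eq_bigr => i _ do rewrite big_split /=.
  rewrite !big_split /=; congr (_ * _).
    rewrite (exchange_big_dep xpredT) //=; apply: eq_bigr => j _.
    have -> : lo j = \prod_(0 * K <= t < j * K) (q ^+ (j * K) - q ^+ t) by rewrite mul0n.
    rewrite -prod_nat_blocks // [RHS]big_mkord.
    pose B i := \prod_(0 <= k < K) (q ^+ (j * K) - q ^+ (i * K + k)).
    rewrite -[RHS]/(\prod_(i < j) B i) (big_ord_widen n.+1 B (ltnW (ltn_ord j))) /B.
    apply: eq_bigr => i _; rewrite big_mkord; apply: eq_bigr => k _.
    by rewrite -exprD addnC.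
  apply: eq_bigr => i _; rewrite /up -prod_nat_blocks // big_geq_mkord /=.
  by apply: eq_bigr => j _; rewrite big_mkord; apply: eq_bigr => k _; rewrite -exprD addnC addnS.
(* Both [up i] and [hi i] have [(n - i) * K] factors, so the same power of [q] comes out of each. *)
have upE i : (i <= n)%N -> up i * qfact q K = hi i * X (n - i)%N.
  move=> le.
  have [r def_n] : exists r, n = (i + r)%N by exists (n - i)%N; rewrite subnKC.
  have -> : hi i = q ^+ (i * K * (r * K)) * qfact q (r * K).
    have := prod_geom_shift q (i * K) 0 (r * K).
    by rewrite addn0 add0n big_mkord -mulnDl -def_n.
  have -> : up i = q ^+ (i * K * (r * K)) * \prod_(K <= t < K + r * K) (1 - q ^+ t.+1).
    have := prod_geom_shift q (i * K) K (r * K).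
    by rewrite addnCA -mulnDl -def_n -mulSn addnC -mulSn.
  rewrite def_n addKn -!mulrA; congr (_ * _); rewrite -qfactX mulrC mulSn.
  rewrite /qfact -!(big_mkord xpredT (fun t => 1 - q ^+ t.+1)).
  by rewrite [RHS](@big_cat_nat _ _ _ K) //= leq_addr.
rewrite def_dyson big_split /= -mulrA -[X in _ ^+ X]card_ord -prodr_const -big_split /=.
rewrite [X in _ * X](eq_bigr (fun i : 'I_n.+1 => hi i * X (n - i)%N)); last first.
  by move=> i _; rewrite upE // -ltnS ltn_ord.
rewrite [in RHS](eq_bigr _ (fun i _ => def_grid i)) !big_split /= mulrA mulrC; congr (_ * _).
rewrite (reindex_inj rev_ord_inj) /=.
rewrite (eq_bigr (fun i : 'I_n.+1 => X i)) => [|i _]; last first.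
  by rewrite subSS subKn // -ltnS ltn_ord.
elim: n.+1 => [|m IHm]; first by rewrite big_ord0 /qfact big_ord0.
by rewrite big_ord_recr /= IHm qfactX.
Qed.

Definition dysonX (R : comNzRingType) (q : R) (N : nat) (a b : 'I_N -> 'I_N -> nat) :
    {mpoly R[N]} :=
  dyson q%:MP a b (fun i => 'X_i).

Lemma dhomog_bigprod (R : comNzRingType) (N : nat) (I : Type) (r : seq I) (P : pred I)
    (F : I -> {mpoly R[N]}) (d : I -> nat) :
  (forall i, P i -> F i \is (d i).-homog) ->
  \prod_(i <- r | P i) F i \is (\sum_(i <- r | P i) d i).-homog.
Proof.
by move=> h; apply: (big_ind2 (fun p e => p \is e.-homog)) => //;
  [exact: dhomog1 | move=> *; exact: dhomogM].
Qed.

Lemma dysonX_homog (R : comNzRingType) (q : R) N (a b : 'I_N -> 'I_N -> nat) :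
  dysonX q a b \is (\sum_(i < N) \sum_(j < N | (i < j)%N) (a i j + b i j)).-homog.
Proof.
have lin k i j : 'X_i - (q%:MP) ^+ k * 'X_j \is [in R[N], 1.-homog].
  have lx t : 'X_t \is [in R[N], 1.-homog] by rewrite dhomogX /= mdeg1.
  by rewrite -rmorphXn /= mul_mpolyC rpredB ?rpredZ.
apply: dhomog_bigprod => i _; apply: dhomog_bigprod => j _.
have card n : (\sum_(k < n) 1 = n)%N by rewrite sum1_card card_ord.
by apply: dhomogM; rewrite -[X in X.-homog]card; apply: dhomog_bigprod => k _.
Qed.

(* Karasev-Petrov: on the grid [{1, q, .., q^(nK)}^(n+1)] the product vanishes
   except at the point [x_i = q^(iK)]. *)
Lemma dyson_ct_field (F : fieldType) (q : F) (n K : nat) :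
  (0 < K)%N -> q != 0 -> (forall k, (0 < k)%N -> q ^+ k != 1) ->
  (dysonX q (fun _ _ => K) (fun _ _ => K))@_[multinom (n * K)%N | i < n.+1]
    * qfact q K ^+ n.+1 = qfact q (n.+1 * K).
Proof.
move=> K0 q0 q1.
have injq : injective (fun k => q ^+ k).
  move=> i j /= e; wlog lt : i j e / (i < j)%N.
    by move=> H; case: (ltngtP i j) => // h; [exact: H | symmetry; exact: H].
  have := q1 (j - i)%N; rewrite subn_gt0 => /(_ lt) /eqP[].
  apply: (mulfI (expf_neq0 i q0)); by rewrite -exprD subnKC ?mulr1 // ltnW.
pose al0 : {ffun 'I_n.+1 -> 'I_(n * K).+1} := [ffun i : 'I_n.+1 => inord (i * K)].
have al0E i : al0 i = (i * K)%N :> nat.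
  by rewrite ffunE inordK // ltnS leq_mul2r -ltnS ltn_ord orbT.
rewrite (@mcoeff_grid _ _ (n * K) (fun k => q ^+ k)); first last.
- move=> m /(dhomog_mf (dysonX_homog _ _ _)) ->.
  rewrite (big_ltn_gtn _ (fun _ _ => K)) (eq_bigr (fun=> n * K)%N).
    by rewrite sum_nat_const card_ord.
  by move=> i _; rewrite sum_nat_const cardC1 card_ord.
- by move=> i j _ _; exact: injq.
have mevalE (f : {ffun 'I_n.+1 -> 'I_(n * K).+1}) :
   (dysonX q (fun _ _ => K) (fun _ _ => K)).@[fun i => q ^+ f i] =
   dyson q (fun _ _ => K) (fun _ _ => K) (fun i => q ^+ f i).
  by rewrite /dysonX rmorph_dyson /= mevalC; apply: eq_dyson => // i; rewrite mevalXU.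
rewrite (bigD1 al0) //= [X in _ + X]big1 ?addr0 => [|f neq_f].
  rewrite mevalE; have := dyson_geom q n K.
  have -> : dyson q (fun _ _ => K) (fun _ _ => K) (fun i => q ^+ al0 i) =
      dyson q (fun _ _ => K) (fun _ _ => K) (fun i : 'I_n.+1 => q ^+ (i * K)).
    by apply: eq_dyson => // i; rewrite al0E.
  have -> : \prod_i \prod_(j < (n * K).+1 | j != al0 i) (q ^+ al0 i - q ^+ j) =
     \prod_(i < n.+1) \prod_(j < (n * K).+1 | j != (i * K)%N :> nat) (q ^+ (i * K) - q ^+ j).
    apply: eq_bigr => i _; rewrite al0E; apply: eq_bigl => j.
    by rewrite -val_eqE /= al0E.
  move=> e; rewrite mulrAC e mulfK //.
  apply/prodf_neq0 => i _; apply/prodf_neq0 => j; apply: contra.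
  by rewrite subr_eq0 => /eqP /injq ->.
apply/eqP; rewrite mulf_eq0; apply/orP; left; rewrite mevalE.
apply: contraNT neq_f => nz; apply/eqP/ffunP => i; apply: val_inj; rewrite /= al0E.
apply: (@dyson_point n K (fun i => f i) K0) => [j|j k lt_jk]; first by rewrite -ltnS ltn_ord.
(* For [j < k], nonvanishing says that [f k - f j] avoids 0, .., [K - 1] and [f j - f k] avoids 1,
   .., [K]. This is the separation that [dyson_point] requires. *)
have /prodf_neq0 /(_ j isT) /prodf_neq0 /(_ k lt_jk) := nz.
rewrite mulf_eq0 negb_or => /andP[/prodf_neq0 h1 /prodf_neq0 h2].
have {}h1 t : (t < K)%N -> (f k != f j + t :> nat)%N.
  move=> lt; apply: contra (h1 (Ordinal lt) isT) => /eqP e /=.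
  by rewrite e -exprD addnC subrr.
have {}h2 t : (t < K)%N -> (f j != f k + t.+1 :> nat)%N.
  move=> lt; apply: contra (h2 (Ordinal lt) isT) => /eqP e /=.
  by rewrite e -exprD addnC subrr.
have [le|lt] := leqP (f j) (f k).
  by have := h1 (f k - f j)%N; lia.
by have := h2 (f j - f k).-1%N; lia.
Qed.

(** The grid formula divides, so it is applied in the fraction field, where ['X] is neither zero nor
    a root of unity; the embedding is injective. *)
Lemma dyson_ct (n K : nat) : (0 < K)%N ->
  (dysonX ('X : {poly rat}) (fun _ _ => K) (fun _ _ => K))@_[multinom (n * K)%N | i < n.+1]
    * qfact 'X K ^+ n.+1 = qfact 'X (n.+1 * K).
Proof.
move=> K0; apply/eqP; rewrite -tofrac_eq; apply/eqP.
pose f := [the {rmorphism {poly rat} -> {fraction {poly rat}}} of @tofrac {poly rat}].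
have fX k : (0 < k)%N -> f 'X ^+ k != 1.
  move=> k0; rewrite -rmorphXn /= -tofrac1 tofrac_eq.
  apply: contraTneq k0 => /(congr1 (fun p : {poly rat} => size p)).
  by rewrite size_polyXn size_poly1 => -[->].
have f0 : f 'X != 0 by rewrite /= tofrac_eq0 polyX_eq0.
rewrite -[LHS]/(f _) -[RHS]/(f _) rmorphM rmorphXn !rmorph_qfact.
rewrite -(dyson_ct_field n K0 f0 fX).
congr (_ * _); rewrite -mcoeff_map_mpoly /dysonX rmorph_dyson /= map_mpolyC.
by congr (_@__); apply: eq_dyson => // i; rewrite map_mpolyX.
Qed.

(** * Truncation modulo a power of q *)

Definition eqmod (S : comNzRingType) (d x y : S) : Prop := exists w, x = y + d * w.

Section EqMod.
Variables (S : comNzRingType) (d : S).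
Local Notation "x ≡ y" := (eqmod d x y) (at level 70).

Lemma eqmod_refl x : x ≡ x. Proof. by exists 0; rewrite mulr0 addr0. Qed.

Lemma eqmod_sym x y : x ≡ y -> y ≡ x.
Proof. by case=> w ->; exists (- w); rewrite mulrN addrK. Qed.

Lemma eqmod_trans x y z : x ≡ y -> y ≡ z -> x ≡ z.
Proof. by case=> v -> [w ->]; exists (w + v); rewrite mulrDr addrA. Qed.

Lemma eqmodD x y z t : x ≡ y -> z ≡ t -> x + z ≡ y + t.
Proof. by case=> v -> [w ->]; exists (v + w); rewrite mulrDr addrACA. Qed.

Lemma eqmodM x y z t : x ≡ y -> z ≡ t -> x * z ≡ y * t.
Proof.
by case=> v -> [w ->]; exists (v * t + y * w + d * v * w); ring.
Qed.

Lemma eqmodMl z x y : x ≡ y -> z * x ≡ z * y.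
Proof. by apply: eqmodM; exact: eqmod_refl. Qed.

Lemma eqmod_sum (I : Type) (r : seq I) (P : pred I) (F G : I -> S) :
  (forall i, P i -> F i ≡ G i) -> \sum_(i <- r | P i) F i ≡ \sum_(i <- r | P i) G i.
Proof.
by move=> h; apply: big_ind2 => //; [exact: eqmod_refl | move=> *; exact: eqmodD].
Qed.

Lemma eqmod_prod (I : Type) (r : seq I) (P : pred I) (F G : I -> S) :
  (forall i, P i -> F i ≡ G i) -> \prod_(i <- r | P i) F i ≡ \prod_(i <- r | P i) G i.
Proof.
by move=> h; apply: big_ind2 => //; [exact: eqmod_refl | move=> *; exact: eqmodM].
Qed.

Lemma eqmod_prod_tail (F : nat -> S) (y : S) (c b : nat) :
  (c <= b)%N -> (forall k, (c <= k)%N -> F k ≡ y) ->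
  \prod_(k < b) F k ≡ y ^+ (b - c) * \prod_(k < c) F k.
Proof.
move=> le h; rewrite -(subnKC le) addKn; elim: (b - c)%N => [|r IHr].
  by rewrite addn0 expr0 mul1r; exact: eqmod_refl.
rewrite addnS big_ord_recr /= exprS -mulrA [y * _]mulrC.
by apply: eqmodM => //; exact: h (leq_addr _ _).
Qed.

End EqMod.

Lemma eqmod_exp_sub (S : comNzRingType) (q x y : S) (m k : nat) : (m <= k)%N ->
  eqmod (q ^+ m) (y - q ^+ k * x) y.
Proof.
by move=> le; exists (- (q ^+ (k - m) * x)); rewrite mulrN mulrA -exprD subnKC.
Qed.

(** Modulo [q ^+ M.+1], a factor [y - q ^+ k * x] with [k > M] is just [y], so larger parameters
    only contribute a monomial. The thresholds [M.+1] and [M] differ because the powers of [q] start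
    at 0 in one product of [dyson_pair] and at 1 in the other. *)
Lemma dyson_trunc (S : comNzRingType) (q : S) N (a b : 'I_N -> 'I_N -> nat)
    (x : 'I_N -> S) (M : nat) :
  (forall i j : 'I_N, (i < j)%N -> (M < a i j)%N /\ (M <= b i j)%N) ->
  eqmod (q ^+ M.+1) (dyson q a b x)
    ((\prod_(i < N) \prod_(j < N | (i < j)%N) (x j ^+ (a i j - M.+1) * x i ^+ (b i j - M)))
       * dyson q (fun _ _ => M.+1) (fun _ _ => M) x).
Proof.
move=> hab; rewrite -big_split /=; apply: eqmod_prod => i _.
rewrite -big_split /=; apply: eqmod_prod => j /hab[la lb].
rewrite /dyson_pair mulrACA; apply: eqmodM.
  by apply: (eqmod_prod_tail (F := fun k => x j - q ^+ k * x i)) => // k le_k /=; exact: eqmod_exp_sub.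
by apply: (eqmod_prod_tail (F := fun k => x i - q ^+ k.+1 * x j)) => // k le_k /=; exact: eqmod_exp_sub.
Qed.

Lemma mcoeff_eqmod (R : comNzRingType) N (d : R) (P Q : {mpoly R[N]}) m :
  eqmod d%:MP P Q -> eqmod d P@_m Q@_m.
Proof. by case=> w ->; exists w@_m; rewrite mcoeffD mcoeffCM. Qed.

(* The exponent standing for the constant term of the Laurent product: the monomial
   by which [dyson] was multiplied to clear denominators. *)
Definition dyson_exp N (a b : 'I_N -> 'I_N -> nat) : 'X_{1..N} :=
  [multinom (\sum_(j < N | i < j) b i j + \sum_(j < N | j < i) a j i)%N | i < N].

Lemma mpolyX_dyson_exp (R : comNzRingType) N (a b : 'I_N -> 'I_N -> nat) :
  \prod_(i < N) \prod_(j < N | (i < j)%N) ('X_j ^+ a i j * 'X_i ^+ b i j)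
  = 'X_[R, dyson_exp a b].
Proof.
rewrite mpolyXE_id; under eq_bigr => i _ do rewrite big_split /=.
rewrite big_split /= (exchange_big_dep xpredT) //= -big_split /=.
apply: eq_bigr => i _; rewrite mnmE addnC exprD -!prodrXr.
by [].
Qed.

Lemma mcoeff_dyson_trunc (R : comNzRingType) (q : R) N (a b : 'I_N -> 'I_N -> nat) M m :
  (forall i j : 'I_N, (i < j)%N -> (M < a i j)%N /\ (M <= b i j)%N) ->
  eqmod (q ^+ M.+1)
    (dysonX q a b)@_(m + dyson_exp (fun i j => a i j - M.+1)%N (fun i j => b i j - M)%N)
    (dysonX q (fun _ _ => M.+1) (fun _ _ => M))@_m.
Proof.
move=> hab; set t := dyson_exp _ _.
have -> : (dysonX q (fun _ _ : 'I_N => M.+1) (fun _ _ => M))@_m =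
    ('X_[t] * dysonX q (fun _ _ => M.+1) (fun _ _ => M))@_(m + t).
  by rewrite mulrC [(m + t)%MM]addmC mcoeffMX.
apply: mcoeff_eqmod; rewrite rmorphXn /= -mpolyX_dyson_exp.
exact: dyson_trunc.
Qed.

(** Stability: the Laurent constant term is the same for all large parameters, even if they vary
    from pair to pair. *)
Lemma mcoeff_dyson_exp_trunc (R : comNzRingType) (q : R) N (a b : 'I_N -> 'I_N -> nat) M :
  (forall i j : 'I_N, (i < j)%N -> (M < a i j)%N /\ (M <= b i j)%N) ->
  eqmod (q ^+ M.+1) (dysonX q a b)@_(dyson_exp a b)
    (dysonX q (fun _ _ => M.+1) (fun _ _ => M))@_(dyson_exp (fun _ _ : 'I_N => M.+1) (fun _ _ => M)).
Proof.
move=> hab; have := mcoeff_dyson_trunc q (dyson_exp (fun _ _ => M.+1) (fun _ _ => M)) hab.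
congr (eqmod _ _@__ _); apply/mnmP => i; rewrite mnmDE !mnmE addnACA -!big_split /=.
by congr (_ + _)%N; apply: eq_bigr => j /hab[*]; rewrite subnKC.
Qed.

(** * Rescaling one variable *)

(** Scaling [x] by [q] shifts the powers of [q] by one: the factor [q * x - q * y] of the second
    product becomes, up to [- q], the missing first factor [y - x] of the other. The next lemma
    scales [y] in the same way. *)
Lemma dyson_pair_scalel (S : comNzRingType) (q : S) a b x y :
  dyson_pair q a b.+1 (q * x) y = - q ^+ b.+1 * dyson_pair q a.+1 b x y.
Proof.
rewrite /dyson_pair [in RHS]big_ord_recl big_ord_recl /= expr0 mul1r expr1.
rewrite (eq_bigr (fun k : 'I_a => y - q ^+ (bump 0 k) * x)); last first.
  by move=> k _; rewrite /bump /= add1n exprSr mulrA.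
rewrite [X in _ * (_ * X)](eq_bigr (fun k : 'I_b => q * (x - q ^+ k.+1 * y))); last first.
  by move=> k _; rewrite ?/bump /= ?add1n exprS mulrBr !mulrA.
rewrite [X in _ * (_ * X)]big_split /= prodr_const card_ord exprS; ring.
Qed.

Lemma dyson_pair_scaler (S : comNzRingType) (q : S) a b x y :
  dyson_pair q b.+1 a x (q * y) = - q ^+ b * dyson_pair q b a.+1 x y.
Proof.
rewrite /dyson_pair [in RHS]big_ord_recl big_ord_recl /= expr0 mul1r expr1.
rewrite (eq_bigr (fun k : 'I_b => q * (y - q ^+ k * x))); last first.
  by move=> k _; rewrite ?/bump /= ?add1n exprS mulrBr !mulrA.
rewrite [X in _ * X = _](eq_bigr (fun k : 'I_a => x - q ^+ (bump 0 k).+1 * y)); last first.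
  by move=> k _; rewrite mulrA -exprSr /bump.
rewrite [\prod_(i < b) (q * _)]big_split /= prodr_const card_ord; ring.
Qed.

(* The parameter is changed only on the pairs containing [i0]: [A] when [i0] comes
   first and [B] when it comes second. *)
Definition star N (i0 : 'I_N) (A B K : nat) : 'I_N -> 'I_N -> nat :=
  fun i j => if i == i0 then A else if j == i0 then B else K.

Definition scale_at (S : comNzRingType) (q : S) N (i0 : 'I_N) (x : 'I_N -> S) : 'I_N -> S :=
  fun i => if i == i0 then q * x i else x i.

(** Of the [n] pairs containing [i0], the [n - i0] with [i0] first give [- q ^+ B.+1] each, and the
    [i0] with [i0] second give [- q ^+ B]. *)
Lemma dyson_scale_at (S : comNzRingType) (q : S) n (i0 : 'I_n.+1) (A B K : nat)
    (x : 'I_n.+1 -> S) :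
  dyson q (star i0 A B.+1 K) (star i0 B.+1 A K) (scale_at q i0 x) =
  (-1) ^+ n * q ^+ (B * n + (n - i0)) * dyson q (star i0 A.+1 B K) (star i0 B A.+1 K) x.
Proof.
pose c (i j : 'I_n.+1) : S :=
  if i == i0 then - q ^+ B.+1 else if j == i0 then - q ^+ B else 1.
have -> : (-1) ^+ n * q ^+ (B * n + (n - i0)) =
    \prod_(i < n.+1) \prod_(j < n.+1 | (i < j)%N) c i j.
  rewrite (bigD1 i0) //= (eq_bigr (fun=> - q ^+ B.+1)) => [|j _]; last by rewrite /c eqxx.
  rewrite [X in _ = _ * X](eq_bigr (fun i : 'I_n.+1 => if (i < i0)%N then - q ^+ B else 1)).
    rewrite -big_mkcondr /= [X in _ = _ * X](eq_bigl (fun i : 'I_n.+1 => (i < i0)%N)); last first.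
            by move=> i; rewrite /= andb_idl // => lt; rewrite -val_eqE /= ltn_eqF.
    rewrite -(big_geq_mkord i0.+1 n.+1 xpredT (fun=> - q ^+ B.+1)) prodr_const_nat subSS.
    rewrite -(big_ord_widen n.+1 (fun=> - q ^+ B) (ltnW (ltn_ord i0))) prodr_const card_ord.
    rewrite (exprNn (q ^+ B)) (exprNn (q ^+ B.+1)) -!exprM mulrACA -!exprD.
    have le : (i0 <= n)%N by rewrite -ltnS ltn_ord.
    by congr (_ ^+ _ * _ ^+ _); nia.
  move=> i neq_i; case: ltnP => [lt|le].
    rewrite (bigD1 i0) //= /c (negPf neq_i) eqxx big1 ?mulr1 // => j /andP[_ /negPf ->].
    by [].
  rewrite big1 // => j lt; rewrite /c (negPf neq_i).
  by rewrite -val_eqE /= gtn_eqF // (leq_ltn_trans le).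
rewrite -big_split /=; apply: eq_bigr => i _; rewrite -big_split /=; apply: eq_bigr => j lt_ij.
rewrite /c /star /scale_at; have [ei|ni] := eqVneq i i0.
  have nj : j != i0 by rewrite -ei -val_eqE /= gtn_eqF.
  by rewrite (negPf nj) dyson_pair_scalel.
by have [ej|nj] := eqVneq j i0; rewrite ?mul1r // dyson_pair_scaler.
Qed.

Lemma mcoeff_scale_at (R : comNzRingType) (q : R) N (i0 : 'I_N) (P : {mpoly R[N]}) m :
  (mmap (@mpolyC N R) (scale_at q%:MP i0 (fun i => 'X_i)) P)@_m = q ^+ m i0 * P@_m.
Proof.
have mmap1E m' : mmap1 (scale_at q%:MP i0 (fun i => 'X_i)) m'
    = (q ^+ m' i0) *: 'X_[m'] :> {mpoly R[N]}.
  rewrite /mmap1 (bigD1 i0) //= mpolyXE_id [in RHS](bigD1 i0) //= /scale_at eqxx.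
  rewrite exprMn -rmorphXn /= -mulrA mul_mpolyC; congr (_ *: (_ * _)).
  by apply: eq_bigr => i /negPf ->.
rewrite /mmap raddf_sum /= [in RHS](mpolyE P) raddf_sum mulr_sumr /=.
apply: eq_bigr => m' _; rewrite mmap1E mul_mpolyC !mcoeffZ mcoeffX.
by case: eqVneq => [->|]; rewrite ?mulr0 // !mulr1 mulrC.
Qed.

Lemma mcoeff_star_step (R : comNzRingType) (q : R) n (i0 : 'I_n.+1) A B K (m : 'X_{1..n.+1}) :
  q ^+ m i0 * (dysonX q (star i0 A B.+1 K) (star i0 B.+1 A K))@_m =
  (-1) ^+ n * q ^+ (B * n + (n - i0)) *
    (dysonX q (star i0 A.+1 B K) (star i0 B A.+1 K))@_m.
Proof.
rewrite -mcoeff_scale_at -mcoeffCM; congr (_@__).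
rewrite /dysonX rmorph_dyson /= mmapC rmorphM !rmorphXn rmorphN rmorph1 /=.
rewrite -dyson_scale_at; apply: eq_dyson => // i.
by rewrite mmapX mmap1U.
Qed.

(** Iterates the previous step while the parameter decreases from [B + p] to [B]; summing these
    parameters produces [p * B + 'C(p, 2)]. *)
Lemma mcoeff_star (R : comNzRingType) (q : R) n (i0 : 'I_n.+1) A B K p (m : 'X_{1..n.+1}) :
  q ^+ (p * m i0) * (dysonX q (star i0 A (B + p) K) (star i0 (B + p) A K))@_m =
  (-1) ^+ (n * p) * q ^+ (p * (B * n) + 'C(p, 2) * n + p * (n - i0)) *
    (dysonX q (star i0 (A + p) B K) (star i0 B (A + p) K))@_m.
Proof.
elim: p A => [|p IHp] A; first by rewrite !(addn0, muln0, mul0n, expr0, mul1r).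
rewrite mulSnr exprD -mulrA addnS mcoeff_star_step mulrCA IHp !mulrA addSnnS.
congr (_ * _); rewrite -!mulrA [X in _ * X]mulrCA -exprD !mulrA -exprD -mulnS.
by congr (_ ^+ _ * _ ^+ _); rewrite ?binS ?bin1; nia.
Qed.

Lemma dysonX_star_diag (R : comNzRingType) (q : R) N (i0 : 'I_N) K :
  dysonX q (star i0 K K K) (star i0 K K K) = dysonX q (fun _ _ => K) (fun _ _ => K).
Proof. by apply: eq_dyson => // i j; rewrite /star; case: ifP => // _; case: ifP. Qed.

(** [mcoeff_star] with [B = K - p], starting from equal parameters. The value of [m i0] makes the
    power of [q] on the left cancel the term [p * (B * n)]. *)
Lemma mcoeff_shift_pos (R : idomainType) (q : R) n (i0 : 'I_n.+1) K p (m : 'X_{1..n.+1}) :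
  q != 0 -> (p <= K)%N -> m i0 = (n * (K - p))%N ->
  (dysonX q (fun _ _ => K) (fun _ _ => K))@_m =
  (-1) ^+ (n * p) * q ^+ ('C(p, 2) * n + p * (n - i0)) *
    (dysonX q (star i0 (K + p) (K - p) K) (star i0 (K - p) (K + p) K))@_m.
Proof.
move=> q0 le_pK mi0.
have := mcoeff_star q i0 K (K - p) K p m; rewrite subnK // dysonX_star_diag mi0.
rewrite [((K - p) * n)%N]mulnC -addnA exprD => h.
apply: (mulfI (expf_neq0 (p * (n * (K - p))) q0)); rewrite h.
by rewrite !mulrA [X in X * _ * _ = _]mulrC.
Qed.

(** [mcoeff_star] read backwards, with equal parameters at the end. The exponent comes from
    [p * p - 'C(p, 2) = 'C(p.+1, 2)]. *)
Lemma mcoeff_shift_neg (R : idomainType) (q : R) n (i0 : 'I_n.+1) K p (m : 'X_{1..n.+1}) :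
  q != 0 -> (p <= K)%N -> m i0 = (n * (K + p))%N ->
  (dysonX q (fun _ _ => K) (fun _ _ => K))@_m =
  (-1) ^+ (n * p) * q ^+ ('C(p.+1, 2) * n - p * (n - i0)) *
    (dysonX q (star i0 (K - p) (K + p) K) (star i0 (K + p) (K - p) K))@_m.
Proof.
move=> q0 le_pK mi0.
have := mcoeff_star q i0 (K - p) K K p m; rewrite subnK // dysonX_star_diag mi0 => h.
apply: (mulfI (expf_neq0 (p * (K * n) + 'C(p, 2) * n + p * (n - i0)) q0)).
have sgn : (-1) ^+ (n * p) * (-1) ^+ (n * p) = 1 :> R.
  by rewrite -exprD addnn -mul2n exprM sqrrN expr1n expr1n.
set E := (p * (K * n) + _ + _)%N in h *; set e := (_ - _)%N.
have -> : forall D, q ^+ E * ((-1) ^+ (n * p) * q ^+ e * D) = (-1) ^+ (n * p) * (q ^+ (E + e) * D).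
  by move=> D; rewrite exprD; ring.
rewrite -[LHS]mul1r -[X in X * _ = _]sgn -mulrA [X in _ * X = _]mulrA -h; congr (_ * (_ ^+ _ * _)).
clear h; rewrite {}/E {}/e.
have le_sub : (p * (n - i0) <= 'C(p.+1, 2) * n)%N.
  case: p {mi0 sgn le_pK} => [|p]; first by rewrite mul0n.
  apply: leq_mul (leq_subr _ _).
  by rewrite binS bin1; lia.
have -> : ('C(p.+1, 2) = 'C(p, 2) + p)%N by rewrite binS bin1.
have hb : ('C(p, 2) + ('C(p, 2) + p) = p * p)%N.
  by elim: p {mi0 sgn le_pK le_sub} => // p IHp; rewrite binS bin1; nia.
have : ('C(p, 2) * n + ('C(p, 2) + p) * n = p * p * n)%N by rewrite -mulnDl hb.
rewrite binS bin1 in le_sub; nia.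
Qed.

(** * Antisymmetry *)

Definition vdm (S : comNzRingType) N (x : 'I_N -> S) : S :=
  \prod_(i < N) \prod_(j < N | (i < j)%N) (x j - x i).

Lemma vdm_det (S : comNzRingType) N (x : 'I_N -> S) :
  vdm x = \det (Vandermonde N (\row_i x i)).
Proof.
rewrite det_Vandermonde; apply: eq_bigr => i _; apply: eq_bigr => j _.
by rewrite !mxE.
Qed.

Lemma vdm_sum (S : comNzRingType) N (x : 'I_N -> S) :
  vdm x = \sum_(s : 'S_N) (-1) ^+ s * \prod_i x (s i) ^+ i.
Proof.
rewrite vdm_det; apply: eq_bigr => s _; congr (_ * _).
by apply: eq_bigr => i _; rewrite !mxE.
Qed.

Lemma vdm_perm (S : comNzRingType) N (x : 'I_N -> S) (s : 'S_N) :
  vdm (fun i => x (s i)) = (-1) ^+ s * vdm x.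
Proof.
rewrite !vdm_det; have -> : Vandermonde N (\row_i x (s i)) =
    col_perm s (Vandermonde N (\row_i x i)) by apply/matrixP => i j; rewrite !mxE.
by rewrite col_permE det_mulmx det_perm odd_permV mulrC.
Qed.

Lemma vdm_rev (S : comNzRingType) N (x : 'I_N -> S) :
  \prod_(i < N) \prod_(j < N | (i < j)%N) (x i - x j) = vdm (fun i => x (rev_ord i)).
Proof.
rewrite /vdm (exchange_big_dep xpredT) //= (reindex_inj rev_ord_inj) /=.
apply: eq_bigr => i _; rewrite (reindex_inj rev_ord_inj) /=; apply: eq_big => // j.
by have := ltn_ord i; have := ltn_ord j; lia.
Qed.

(** This is $\prod_{i\ne j}(x_i/x_j;q)_K$ with denominators cleared by one factor $x_j^K$ per
    ordered pair. *)
Definition theta_prod (S : comNzRingType) (q : S) N K (x : 'I_N -> S) : S :=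
  \prod_(i < N) \prod_(j < N | j != i) \prod_(k < K) (x j - q ^+ k * x i).

(** Splitting off the factor with [k = 0] from one of the two orders of each pair leaves the
    parameters [M.+1] and [M]. *)
Lemma theta_prod_dyson (S : comNzRingType) (q : S) N M (x : 'I_N -> S) :
  theta_prod q M.+1 x = dyson q (fun _ _ => M.+1) (fun _ _ => M) x *
    \prod_(i < N) \prod_(j < N | (i < j)%N) (x i - x j).
Proof.
rewrite /theta_prod -big_ltn_gtn -big_split /=; apply: eq_bigr => i _.
rewrite -big_split /=; apply: eq_bigr => j _; rewrite /dyson_pair -mulrA; congr (_ * _).
by rewrite big_ord_recl expr0 mul1r mulrC.
Qed.

(** Shows the antisymmetry: the second factor is a product over all ordered pairs, hence
    symmetric. *)
Lemma dyson_vdm (S : comNzRingType) (q : S) N M (x : 'I_N -> S) :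
  dyson q (fun _ _ => M.+1) (fun _ _ => M) x = vdm x *
    \prod_(i < N) \prod_(j < N | j != i) \prod_(k < M) (x i - q ^+ k.+1 * x j).
Proof.
rewrite -big_ltn_gtn -big_split /=; apply: eq_bigr => i _.
rewrite -big_split /=; apply: eq_bigr => j _; rewrite /dyson_pair.
by rewrite big_ord_recl expr0 mul1r -!mulrA; congr (_ * _); rewrite mulrC.
Qed.

Lemma dyson_perm (S : comNzRingType) (q : S) N M (x : 'I_N -> S) (s : 'S_N) :
  dyson q (fun _ _ => M.+1) (fun _ _ => M) (fun i => x (s i)) =
  (-1) ^+ s * dyson q (fun _ _ => M.+1) (fun _ _ => M) x.
Proof.
rewrite !dyson_vdm vdm_perm -mulrA; congr (_ * (_ * _)).
rewrite [RHS](reindex_inj (@perm_inj _ s)); apply: eq_bigr => i _.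
rewrite [RHS](reindex_inj (@perm_inj _ s)); apply: eq_bigl => j.
by rewrite (inj_eq perm_inj).
Qed.

Lemma msym_X (R : comNzRingType) N (s : 'S_N) i : msym s 'X_i = 'X_(s i) :> {mpoly R[N]}.
Proof. by rewrite /msym mmapX mmap1U. Qed.

(** Expanding the Vandermonde factor gives signed permuted copies of one monomial. By antisymmetry
    of [dysonX] each summand is a permuted copy of the same product, and the coefficient of a
    symmetric monomial does not see the permutation. *)
Lemma mcoeff_theta_prod (R : comNzRingType) (q : R) n M (p : {mpoly R[n.+1]}) (B : nat) :
  (forall s, msym s p = p) ->
  (theta_prod q%:MP M.+1 (fun i => 'X_i) * p)@_[multinom B | i < n.+1] =
  (n.+1)`!%:R * (dysonX q (fun _ _ => M.+1) (fun _ _ => M) * p *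
     \prod_(i < n.+1) 'X_i ^+ (n - i))@_[multinom B | i < n.+1].
Proof.
move=> symp; pose r : 'S_n.+1 := perm (@rev_ord_inj n.+1).
set D := \prod_(i < n.+1) 'X_i ^+ (n - i).
(* The differences are ['X_i - 'X_j] for [i < j], a Vandermonde product in the reversed variables;
   hence the conjugation by the reversal [r], which preserves signs. *)
have VE : \prod_(i < n.+1) \prod_(j < n.+1 | (i < j)%N) ('X_i - 'X_j) =
    \sum_(s : 'S_n.+1) (-1) ^+ s * msym (r * s * r)%g D.
  rewrite vdm_rev vdm_sum; apply: eq_bigr => s _; congr (_ * _).
  rewrite rmorph_prod (reindex_inj rev_ord_inj) /=; apply: eq_bigr => i _.
  rewrite rmorphXn /= msym_X !permM !permE; congr (_ ^+ _).
rewrite theta_prod_dyson -mulrA [X in _ * X]mulrC mulrA VE mulr_sumr raddf_sum /=.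
rewrite (eq_bigr (fun=> (dysonX q (fun _ _ => M.+1) (fun _ _ => M) * p * D)@_[multinom B | i < n.+1])).
  by rewrite sumr_const card_Sn mulr_natl.
move=> s _; set t := (r * s * r)%g.
have <- : odd_perm t = odd_perm s.
  by rewrite !odd_permM addbC addbA addbb.
have -> : dyson q%:MP (fun _ _ => M.+1) (fun _ _ => M) (fun i => 'X_i) * p *
    ((-1) ^+ t * msym t D) = msym t (dysonX q (fun _ _ => M.+1) (fun _ _ => M) * p * D).
  have -> : msym t (dysonX q (fun _ _ => M.+1) (fun _ _ => M) * p * D) =
      msym t (dysonX q (fun _ _ => M.+1) (fun _ _ => M)) * p * msym t D.
    by rewrite !rmorphM /= symp.
  have -> : msym t (dysonX q (fun _ _ => M.+1) (fun _ _ => M)) =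
      dyson q%:MP (fun _ _ => M.+1) (fun _ _ => M) (fun i => 'X_(t i)).
    rewrite /dysonX rmorph_dyson /= /msym mmapC; apply: eq_dyson => // i.
    exact: msym_X.
  by rewrite (dyson_perm _ _ (fun i => 'X_i)) mulrCA -!mulrA.
rewrite mcoeff_sym; congr (_@__); apply/mnmP => i; by rewrite !mnmE.
Qed.

(** * Lifting term lists to homogeneous polynomials *)

Section Lift.
Variable n : nat.
Local Notation mpol := {mpoly {poly rat}[n.+1]}.
Local Notation lterm := (rat * 'X_{1..n.+1} * nat)%type.

(* Since [s_N = (s_1 .. s_(N-1))^-1], the monomial [x^m] in [N] independent variables
   specialises to the monomial in [s] with exponents [m_j - m_N]. *)
Definition sub_last (m : 'X_{1..n.+1}) (j : 'I_n) : int :=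
  (m (widen_ord (leqnSn n) j))%:Z - (m ord_max)%:Z.

Definition lower (b : 'X_{1..n.+1}) (t : lterm) : term n :=
  (t.1.1, [ffun j => sub_last t.1.2 j - sub_last b j], t.2).

Definition lterm_mpoly (t : lterm) : mpol := (t.1.1 *: 'X^(t.2)) *: 'X_[t.1.2].

(* [P] divided by [x^b] is a degree-homogeneous Laurent polynomial in [N] variables whose
   specialisation is [p]; homogeneity makes the specialisation lossless. *)
Definition lifts (p : poly_s n) (P : mpol) (b : 'X_{1..n.+1}) (d : nat) : Prop :=
  exists L : seq lterm, [/\ p = map (lower b) L, P = \sum_(t <- L) lterm_mpoly t
    & all (fun t => mdeg t.1.2 == d) L].

Lemma sub_lastD m1 m2 j : sub_last (m1 + m2) j = sub_last m1 j + sub_last m2 j.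
Proof. by rewrite /sub_last !mnmDE !PoszD; lia. Qed.

Lemma sub_last_const c m : (forall j, sub_last m j = sub_last [multinom c | i < n.+1] j) ->
  forall i, m i = m ord_max.
Proof.
move=> e i; have [lt|ge] := ltnP i n; last first.
  by congr (m _); apply: val_inj => /=; have := ltn_ord i; lia.
have := e (Ordinal lt); rewrite /sub_last !mnmE.
have -> : widen_ord (leqnSn n) (Ordinal lt) = i by apply: val_inj.
by lia.
Qed.

Lemma lifts_one : lifts (pone n) 1 0%MM 0.
Proof.
exists [:: (1, 0%MM, 0%N)]; split=> /=.
- congr [:: (_, _, _)]; apply/ffunP => j; rewrite !ffunE /sub_last !mnmE; lia.
- by rewrite big_seq1 /lterm_mpoly /= expr0 !scale1r mpolyX0.
- by rewrite mdeg0.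
Qed.

Lemma lifts_mul p1 P1 b1 d1 p2 P2 b2 d2 : lifts p1 P1 b1 d1 -> lifts p2 P2 b2 d2 ->
  lifts (pmul p1 p2) (P1 * P2) (b1 + b2) (d1 + d2).
Proof.
case=> L1 [-> -> /allP h1] [L2 [-> -> /allP h2]].
exists [seq (t.1.1 * u.1.1, (t.1.2 + u.1.2)%MM, (t.2 + u.2)%N) | t <- L1, u <- L2]; split.
- rewrite /pmul allpairs_mapl allpairs_mapr map_allpairs.
  apply: eq_allpairs => t u; congr (_, _, _); apply/ffunP => j; rewrite !ffunE !sub_lastD.
  by ring.
- rewrite big_allpairs_dep mulr_suml; apply: eq_bigr => t _.
  rewrite mulr_sumr; apply: eq_bigr => u _; rewrite /lterm_mpoly /= mpolyXD exprD.
  by rewrite -!mul_mpolyC -!mul_polyC !rmorphM /=; ring.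
- apply/allP => _ /allpairsP[[t u] /= [/h1 /eqP e1 /h2 /eqP e2 ->]] /=.
  by rewrite mdegD e1 e2.
Qed.

Lemma lifts_foldr (I : eqType) (s : seq I) (f : I -> poly_s n -> poly_s n) (F : I -> mpol)
    (b : I -> 'X_{1..n.+1}) (d : I -> nat) :
  (forall i p P b0 d0, i \in s -> lifts p P b0 d0 ->
     lifts (f i p) (F i * P) (b i + b0) (d i + d0)) ->
  forall p P b0 d0, lifts p P b0 d0 ->
  lifts (foldr f p s) (\prod_(i <- s) F i * P) (\big[+%MM/0%MM]_(i <- s) b i + b0)
    (\sum_(i <- s) d i + d0).
Proof.
move=> h p P b0 d0 hp; elim: s h => [|i s IHs] h.
  by rewrite !big_nil mul1r add0m.
rewrite !big_cons -mulrA -addmA -addnA /=; apply: (h); rewrite ?mem_head //.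
by apply: IHs => k *; apply: (h); rewrite // inE; apply/orP; right.
Qed.

(** A term constant in [s] lifts to a constant exponent vector, and its total degree then fixes the
    entries as [a]. *)
Lemma sum_lifts p P b d c a k : lifts p P b d -> b = [multinom c | i < n.+1] ->
  d = (n.+1 * a)%N ->
  \sum_(t <- p | (t.1.2 == mono0 n) && (t.2 == k)) t.1.1 = P@_[multinom a | i < n.+1]`_k.
Proof.
case=> L [-> -> /allP degL] def_b def_d.
rewrite big_map big_mkcond raddf_sum coef_sum /= big_seq [RHS]big_seq.
apply: eq_bigr => t /degL /eqP deg_t.
rewrite /lterm_mpoly mcoeffZ mcoeffX.
have -> : ([ffun j => sub_last t.1.2 j - sub_last b j] == mono0 n) =
    (t.1.2 == [multinom a | i < n.+1]).
  apply/eqP/eqP => [/ffunP e|->]; last first.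
    by apply/ffunP => j; rewrite !ffunE def_b /sub_last !mnmE; lia.
  have e1 : forall i, t.1.2 i = t.1.2 ord_max.
    by apply: (sub_last_const (c := c)) => j; have /eqP := e j; rewrite !ffunE def_b subr_eq0 => /eqP.
  move: deg_t; rewrite mdegE def_d (eq_bigr _ (fun i _ => e1 i)) sum_nat_const card_ord.
  by move/eqP; rewrite eqn_pmul2l // => /eqP e2; apply/mnmP => i; rewrite mnmE e1.
case: eqP => _ /=; last by rewrite mulr0 coef0.
rewrite mulr1 coefZ coefXn eq_sym; by case: eqP; rewrite ?mulr1 ?mulr0.
Qed.

(** A constant exponent vector has degree divisible by [n.+1], so no term can contribute. *)
Lemma sum_lifts0 p P b d c k : lifts p P b d -> b = [multinom c | i < n.+1] ->
  ~~ (n.+1 %| d)%N ->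
  \sum_(t <- p | (t.1.2 == mono0 n) && (t.2 == k)) t.1.1 = 0.
Proof.
case=> L [-> _ /allP degL] def_b ndvd.
rewrite big_map big_seq_cond big1 // => t /andP[/degL /eqP deg_t /andP[/eqP e _]].
case/negP: ndvd; move/ffunP in e.
have e1 : forall i, t.1.2 i = t.1.2 ord_max.
  by apply: (sub_last_const (c := c)) => j; have /eqP := e j; rewrite !ffunE def_b subr_eq0 => /eqP.
by rewrite -deg_t mdegE (eq_bigr _ (fun i _ => e1 i)) sum_nat_const card_ord dvdn_mulr.
Qed.

End Lift.

(** * The coefficient of the integrand *)

Lemma eqmod_coef (M k : nat) (u v : {poly rat}) : eqmod ('X ^+ M.+1) u v -> (k <= M)%N ->
  u`_k = v`_k.
Proof. by case=> w -> le; rewrite coefD coefXnM ltnS le addr0. Qed.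

Lemma qfact_inv_mod (S : comNzRingType) (q : S) (M m : nat) :
  exists w, eqmod (q ^+ M.+1) (qfact q m * w) 1.
Proof.
elim: m => [|m [w hw]].
  by exists 1; rewrite /qfact big_ord0 mulr1; exact: eqmod_refl.
(* The new factor [1 - q ^+ m.+1] is inverted by its truncated geometric series. *)
exists (w * \sum_(j < M.+1) (q ^+ m.+1) ^+ j).
rewrite /qfact big_ord_recr /= mulrACA -[X in eqmod _ _ X]mulr1; apply: eqmodM => //.
rewrite -opprB mulNr -subrX1 opprB.
exists (- q ^+ (m * M.+1)); rewrite mulrN -exprD -exprM mulSn.
by [].
Qed.

Lemma qfact_trunc (S : comNzRingType) (q : S) (M K : nat) : (M <= K)%N ->
  eqmod (q ^+ M.+1) (qfact q K) (qfact q M).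
Proof.
move=> le; rewrite -[X in eqmod _ _ X]mul1r -(expr1n _ (K - M)).
apply: (eqmod_prod_tail (F := fun k => 1 - q ^+ k.+1)) => // k lek /=.
by rewrite -[q ^+ k.+1]mulr1; exact: eqmod_exp_sub.
Qed.

Lemma dyson_exp_const n (a b : nat) :
  dyson_exp (fun _ _ => a) (fun _ _ => b) = [multinom ((n - i) * b + i * a)%N | i < n.+1].
Proof.
apply/mnmP => i; rewrite !mnmE.
rewrite -(big_geq_mkord i.+1 n.+1 xpredT (fun=> b)).
rewrite -(big_ord_widen n.+1 (fun=> a) (ltnW (ltn_ord i))) sum_nat_const_nat.
by rewrite sum_nat_const card_ord subSS.
Qed.

(** [dyson_ct] at [K = M.+1] reduces modulo ['X ^+ M.+1] to an identity between [n.+1] factors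
    [qfact 'X M] times the constant term and a single [qfact 'X M], which is invertible there. *)
Lemma dyson_ct_limit (n M : nat) :
  eqmod ('X ^+ M.+1)
    (qfact 'X M ^+ n * (dysonX ('X : {poly rat}) (fun _ _ => M.+1) (fun _ _ => M))@_
       (dyson_exp (fun _ _ : 'I_n.+1 => M.+1) (fun _ _ => M))) 1.
Proof.
set c := (_@__); have [w hw] := qfact_inv_mod ('X : {poly rat}) M M.
have hc := @mcoeff_dyson_exp_trunc _ ('X : {poly rat}) n.+1 (fun _ _ => M.+1) (fun _ _ => M.+1) M.
have {}hc : eqmod ('X ^+ M.+1)
    (dysonX ('X : {poly rat}) (fun _ _ : 'I_n.+1 => M.+1) (fun _ _ => M.+1))@_
      [multinom (n * M.+1)%N | i < n.+1] c.
  have -> : [multinom (n * M.+1)%N | i < n.+1] = dyson_exp (fun _ _ => M.+1) (fun _ _ => M.+1).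
    by rewrite dyson_exp_const; apply/mnmP => i; rewrite !mnmE -mulnDl subnK // -ltnS ltn_ord.
  by apply: hc => i j _; rewrite ltnSn leqnSn.
have h1 : eqmod ('X ^+ M.+1) (c * qfact 'X M ^+ n.+1) (qfact 'X M).
  apply: eqmod_trans (qfact_trunc _ (_ : M <= n.+1 * M.+1)%N); last by nia.
  rewrite -(dyson_ct n (ltn0Sn M)); apply: eqmodM; first exact: eqmod_sym.
  rewrite -[X in qfact _ _ ^+ X]card_ord -[X in eqmod _ _ (_ ^+ X)](card_ord n.+1) -!prodr_const.
  by apply: eqmod_prod => i _; apply/eqmod_sym/qfact_trunc.
apply: eqmod_trans (hw); apply: eqmod_sym.
apply: eqmod_trans (_ : eqmod _ (c * qfact 'X M ^+ n.+1 * w) _).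
  by apply: eqmodM; [exact: eqmod_sym | exact: eqmod_refl].
have -> : c * qfact 'X M ^+ n.+1 * w = qfact 'X M ^+ n * c * (qfact 'X M * w).
  by rewrite exprS; ring.
by rewrite -[X in eqmod _ _ X]mulr1; apply: eqmodM; [exact: eqmod_refl|].
Qed.

(** The exponent of [q] in the [i]-th summand of the right-hand side for [N = n + 1]. *)
Definition shift_exp (n : nat) (l : int) (i : nat) : int :=
  n%:Z * ((l * (l - 1)) %/ 2)%Z + l * i%:Z.

(* The exponent [l (1, .., 1) - l N e_i0], translated by the constant-term exponent [n K]
   of the q-Dyson product in [n + 1] variables. *)
Definition shift_mnm n (K : nat) (l : int) (i0 : 'I_n.+1) : 'X_{1..n.+1} :=
  [multinom if i == i0 then absz (n%:Z * (K%:Z - l))%R else absz (n%:Z * K%:Z + l)%R | i < n.+1].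

(** An index other than [i0] meets [i0] once, with parameter [A], and the other [n - 1] indices with
    parameter [K]. *)
Lemma dyson_exp_star n (i0 : 'I_n.+1) A B K :
  dyson_exp (star i0 A B K) (star i0 B A K) =
  [multinom (if i == i0 then n * B else n * K + A - K)%N | i < n.+1].
Proof.
have big_split_at (i : 'I_n.+1) (F : 'I_n.+1 -> nat) :
    (\sum_(j < n.+1 | i < j) F j + \sum_(j < n.+1 | j < i) F j = \sum_(j < n.+1 | j != i) F j)%N.
  rewrite [RHS](bigID (fun j : 'I_n.+1 => (i < j)%N)) /=.
  by congr (_ + _)%N; apply: eq_bigl => j; rewrite -val_eqE /=; case: ltngtP.
apply/mnmP => i; rewrite !mnmE.
rewrite (eq_bigr (fun j => if i == i0 then B else if j == i0 then A else K)) //.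
rewrite [X in (_ + X)%N](eq_bigr (fun j => if i == i0 then B else if j == i0 then A else K)).
  rewrite big_split_at; case: eqP => [->|/eqP ni].
    by rewrite sum_nat_const cardC1 card_ord.
  rewrite (bigD1 i0) 1?eq_sym //= eqxx.
  rewrite (eq_bigr (fun=> K)) => [|j /andP[_ /negPf ->]] //.
  have <- : (\sum_(j < n.+1 | j != i) K = n * K)%N.
    by rewrite sum_nat_const cardC1 card_ord.
  by rewrite [in RHS](bigD1 i0) 1?eq_sym //= -addnA addKn addnC.
move=> j lt; rewrite /star; case: (eqVneq j i0) => [ej|nj]; case: eqVneq => // ei.
by rewrite ei ej ltnn in lt.
Qed.

Lemma shift_exp_pos n p i : shift_exp n p%:Z i = ('C(p, 2) * n + p * i)%N%:Z.
Proof.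
rewrite /shift_exp.
have -> : (p%:Z * (p%:Z - 1) = 'C(p, 2)%:Z * 2)%R.
  by elim: p => // p IHp; rewrite binS bin1 PoszD; lia.
by rewrite mulzK // PoszD !PoszM mulrC.
Qed.

(** For [l = - p] the number $l(l-1)/2$ is ['C(p.+1, 2)]. The natural subtraction is exact since
    [i <= n]. *)
Lemma shift_exp_neg n p i : (i <= n)%N ->
  shift_exp n (- p%:Z) i = ('C(p.+1, 2) * n - p * i)%N%:Z.
Proof.
move=> le; rewrite /shift_exp.
have -> : (- p%:Z * (- p%:Z - 1) = 'C(p.+1, 2)%:Z * 2)%R.
  by elim: p => // p IHp; rewrite binS bin1 PoszD; lia.
rewrite mulzK // -subzn ?PoszM ?mulNr ?[n%:Z * _]mulrC //.
case: p => [|p]; first by rewrite mul0n.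
by apply: leq_mul => //; rewrite binS bin1; lia.
Qed.

(** [shift_mnm] is the constant-term exponent of the product obtained after rescaling [i0]. The
    bound on [K] keeps all its parameters above [M], so that constant term is the stable one. *)
Lemma dyson_shift n M K (l : int) (i0 : 'I_n.+1) : (M + absz l < K)%N ->
  eqmod ('X ^+ M.+1)
    (dysonX ('X : {poly rat}) (fun _ _ => K) (fun _ _ => K))@_(shift_mnm K l i0)
    ((-1) ^+ (n * absz l) * 'X ^+ absz (shift_exp n l (n - i0)) *
     (dysonX 'X (fun _ _ => M.+1) (fun _ _ => M))@_
       (dyson_exp (fun _ _ : 'I_n.+1 => M.+1) (fun _ _ => M))).
Proof.
have q0 : 'X != 0 :> {poly rat} by rewrite polyX_eq0.
have good A B : (M < A)%N -> (M < B)%N -> (M < K)%N -> forall i j : 'I_n.+1, (i < j)%N ->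
    (M < star i0 A B K i j)%N /\ (M <= star i0 B A K i j)%N.
  by move=> ltA ltB ltK i j _; rewrite /star; case: ifP => _; [|case: ifP => _]; split; lia.
case: l => p; [|rewrite NegzE; move: p.+1 => {}p]; rewrite ?abszN absz_nat => ltK.
  have -> : shift_mnm K p i0 = dyson_exp (star i0 (K + p) (K - p) K) (star i0 (K - p) (K + p) K).
    rewrite dyson_exp_star; apply/mnmP => i; rewrite !mnmE; case: eqP => _; last by lia.
    by rewrite subzn; [rewrite -PoszM absz_nat | lia].
  rewrite (@mcoeff_shift_pos _ 'X n i0 K p) //; first last.
  - by rewrite dyson_exp_star mnmE eqxx.
  - by lia.
  rewrite shift_exp_pos absz_nat; apply: eqmodM; first exact: eqmod_refl.
  by apply: mcoeff_dyson_exp_trunc; apply: good; lia.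
have -> : shift_mnm K (- p%:Z) i0 = dyson_exp (star i0 (K - p) (K + p) K) (star i0 (K + p) (K - p) K).
  rewrite dyson_exp_star; apply/mnmP => i; rewrite !mnmE; case: eqP => [_|ni].
    by rewrite opprK -PoszD -PoszM absz_nat.
  have n0 : (0 < n)%N.
    case: n i i0 ni {good} => // i i0 []; apply: val_inj => /=.
    by have := ltn_ord i; have := ltn_ord i0; lia.
  have : (K <= n * K)%N by rewrite leq_pmull.
  by rewrite -PoszM; lia.
rewrite (@mcoeff_shift_neg _ 'X n i0 K p) //; first last.
- by rewrite dyson_exp_star mnmE eqxx.
- by lia.
rewrite shift_exp_neg ?leq_subr // absz_nat; apply: eqmodM; first exact: eqmod_refl.
by apply: mcoeff_dyson_exp_trunc; apply: good; lia.
Qed.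

(** The monomial $s_{i_0}^m$, with $|m|$ added to every exponent to avoid negative ones. *)
Definition wilson_mnm n (m : int) (i0 : 'I_n.+1) : 'X_{1..n.+1} :=
  [multinom absz (`|m| + (if i == i0 then m else 0))%R | i < n.+1].

Lemma mcoeff_dyson_wilson n M (l : int) (i0 : 'I_n.+1) :
  let m := l * n.+1%:Z in
  eqmod ('X ^+ M.+1)
    (dysonX ('X : {poly rat}) (fun _ _ => M.+1) (fun _ _ => M) * 'X_[wilson_mnm m i0] *
      \prod_(i < n.+1) 'X_i ^+ (n - i))@_[multinom (n * M.+1 + absz (`|m| + l)%R)%N | i < n.+1]
    ((-1) ^+ (n * absz l) * 'X ^+ absz (shift_exp n l (n - i0)) *
     (dysonX 'X (fun _ _ => M.+1) (fun _ _ => M))@_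
       (dyson_exp (fun _ _ : 'I_n.+1 => M.+1) (fun _ _ => M))).
Proof.
move=> m; pose K := (M + absz l).+1.
apply: eqmod_trans (@dyson_shift n M K l i0 (ltnSn _)).
set A := dysonX _ _ _; set D := \prod_(i < _) _.
pose T := [multinom (n * (absz l))%N | i < n.+1].
rewrite -(mcoeffMX _ T) -mulrA.
(* Since [K - M.+1] is $|l|$ and [K - M] is $|l|+1$, raising both parameters to [K] costs
   $(n-i)(|l|+1)+i|l| = n|l|+(n-i)$ in variable [i], which is exactly [T] together with [D]. *)
have -> : D * 'X_[T] = 'X_[dyson_exp (fun _ _ => K - M.+1)%N (fun _ _ => K - M)%N].
  rewrite /D dyson_exp_const (mpolyXE_id _ T) [in RHS]mpolyXE_id -big_split /=.
  apply: eq_bigr => i _; rewrite -exprD !mnmE; congr (_ ^+ _).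
  by rewrite /K; have := ltn_ord i; nia.
rewrite mulrAC.
have -> : (T + [multinom (n * M.+1 + absz (`|m| + l)%R)%N | i < n.+1])%MM =
   (wilson_mnm m i0 + shift_mnm K l i0)%MM.
  apply/mnmP => i; rewrite !mnmE /m /K.
  have norm_m (p : nat) : `|p%:Z * n.+1%:Z| = (p * n.+1)%N%:Z by rewrite -PoszM ger0_norm.
  case: l @m @K @T => p /=; [|rewrite NegzE; move: p.+1 => {}p];
    rewrite ?mulNr ?normrN norm_m ?abszN ?absz_nat.
    case: eqP => _.
      have -> : ((M + p).+1%:Z - p%:Z = M.+1%:Z)%R by lia.
      by rewrite -!PoszM -!PoszD !absz_nat; nia.
    by rewrite addr0 !absz_nat; nia.
  have -> : ((p * n.+1)%N%:Z - p%:Z = (p * n)%N%:Z)%R by lia.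
  case: eqP => [_|ni].
    by rewrite -PoszM subrr !absz_nat /=; nia.
  have n0 : (0 < n)%N.
    case: n i i0 ni {norm_m A D} => // i i0 []; apply: val_inj => /=.
    by have := ltn_ord i; have := ltn_ord i0; lia.
  have -> : (n%:Z * (M + p).+1%:Z - p%:Z = (n * (M + p).+1 - p)%N%:Z)%R.
    by rewrite -?PoszM subzn //; nia.
  by rewrite addr0 !absz_nat; nia.
rewrite -[X in eqmod _ _ X](mcoeffMX _ (wilson_mnm m i0)); apply: mcoeff_eqmod.
apply: eqmodM; last exact: eqmod_refl.
apply: eqmod_sym; rewrite mulrC rmorphXn /= -mpolyX_dyson_exp.
by apply: dyson_trunc => i j _; rewrite /K; lia.
Qed.

(** * Lifting the factors of the truncated integrand *)

Section Integrand.
Variable n : nat.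
Local Notation mpol := {mpoly {poly rat}[n.+1]}.

Lemma sub_last_U (i : 'I_n.+1) (j : 'I_n) : sub_last U_(i) j = (@expo n.+1 i : mono n) j.
Proof.
rewrite /sub_last !mnmE ffunE /= -!val_eqE /=.
have := ltn_ord i; rewrite ltnS leq_eqVlt => /predU1P[e|lt].
  by rewrite e ltnn eqxx /= gtn_eqF ?ltn_ord.
by rewrite lt (ltn_eqF lt) subr0 eq_sym; case: eqP.
Qed.

Lemma lifts_qfac (i j : 'I_n.+1) k :
  lifts (qfac [ffun t => (@expo n.+1 i : mono n) t - (@expo n.+1 j : mono n) t] k)
    ('X_j - ('X : {poly rat})%:MP ^+ k * 'X_i : mpol) U_(j) 1.
Proof.
exists [:: (1, U_(j)%MM, 0%N); (-1, U_(i)%MM, k)]; split.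
- rewrite /= /lower /qfac /=; congr [:: (_, _, _); (_, _, _)]; apply/ffunP => t;
  by rewrite !ffunE ?sub_last_U ?subrr // !ffunE.
- rewrite big_cons big_seq1 /lterm_mpoly /= expr0 !scale1r scaleN1r -rmorphXn /=.
  by rewrite mul_mpolyC scaleNr.
- by rewrite /= !mdeg1.
Qed.

Lemma lifts_qfac0 k :
  lifts (qfac (mono0 n) k) ((1 - ('X : {poly rat}) ^+ k)%:MP : mpol) 0%MM 0.
Proof.
have e0 : mono0 n = [ffun j => sub_last 0 j - sub_last 0 j].
  by apply/ffunP => j; rewrite !ffunE subrr.
exists [:: (1, 0%MM, 0%N); (-1, 0%MM, k)]; split.
- by rewrite /= /lower /qfac /= -e0.
- rewrite big_cons big_seq1 /lterm_mpoly /= expr0 !scale1r scaleN1r mpolyX0.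
  by rewrite rmorphB rmorph1 /= scaleNr -mul_mpolyC mulr1.
- by rewrite /= !mdeg0.
Qed.

Lemma lifts_sum_power (m : int) :
  lifts [seq (1, [ffun t => (@expo n.+1 i : mono n) t * m], 0%N) | i <- enum 'I_n.+1]
    (\sum_(i < n.+1) 'X_[wilson_mnm m i] : mpol) [multinom absz m | i < n.+1]
    (n * absz m + absz (`|m| + m)%R).
Proof.
exists [seq (1, wilson_mnm m i, 0%N) | i <- enum 'I_n.+1]; split.
- rewrite -[RHS](map_comp (lower _)); apply: eq_map => i /=; congr (_, _, _); apply/ffunP => t.
  rewrite ffunE [RHS]ffunE -sub_last_U /sub_last !mnmE ![i == _]eq_sym.
  by do 2![case: eqP => _] => /=; lia.
- rewrite big_map big_enum; apply: eq_bigr => i _.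
  by rewrite /lterm_mpoly /= expr0 !scale1r.
- apply/allP => _ /mapP[i _ ->] /=; rewrite mdegE (bigD1 i) //= mnmE eqxx.
  rewrite (eq_bigr (fun=> absz m)) => [|j /negPf ne]; last by rewrite mnmE ne; lia.
  by rewrite sum_nat_const cardC1 card_ord addnC.
Qed.

Lemma lifts_eq p P P' b b' d d' :
  @lifts n p P b d -> P = P' -> b = b' -> d = d' -> lifts p P' b' d'.
Proof. by move=> h <- <- <-. Qed.

Lemma foldr_flatten (S T : Type) (f : S -> T -> T) (z : T) (ss : seq (seq S)) :
  foldr f z (flatten ss) = foldr (fun s a => foldr f a s) z ss.
Proof. by elim: ss => //= s ss IH; rewrite foldr_cat IH. Qed.

Lemma lifts_theta_prod M p P b d : lifts p P b d ->
  lifts (foldr (@pmul n) p (flatten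
    [seq [seq qfac [ffun t => (@expo n.+1 i : mono n) t - (@expo n.+1 j : mono n) t] k
         | k <- iota 0 M.+1]
       | i <- enum 'I_n.+1, j <- [seq j <- enum 'I_n.+1 | j != i]]))
   (theta_prod ('X : {poly rat})%:MP M.+1 (fun i => 'X_i) * P : mpol)
   ([multinom (n * M.+1)%N | i < n.+1] + b) (n.+1 * (n * M.+1) + d).
Proof.
move=> hp; rewrite !foldr_flatten foldr_map.
pose F (i j : 'I_n.+1) (k : nat) : mpol := 'X_j - ('X : {poly rat})%:MP ^+ k * 'X_i.
pose b1 (j : 'I_n.+1) : 'X_{1..n.+1} := \big[+%MM/0%MM]_(k <- iota 0 M.+1) U_(j)%MM.
pose d1 (j : 'I_n.+1) : nat := (\sum_(k <- iota 0 M.+1) 1)%N.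
pose s (i : 'I_n.+1) := [seq j <- enum 'I_n.+1 | j != i].
apply: lifts_eq (lifts_foldr
  (F := fun i => \prod_(j <- s i) \prod_(k <- iota 0 M.+1) F i j k)
  (b := fun i => \big[+%MM/0%MM]_(j <- s i) b1 j)
  (d := fun i => (\sum_(j <- s i) d1 j)%N) _ hp) _ _ _.
- move=> i p1 P1 b0 d0 _ hp1; rewrite foldr_map.
  apply: (lifts_foldr (F := fun j => \prod_(k <- iota 0 M.+1) F i j k)) hp1.
  move=> j p2 P2 b2 d2 _ hp2; rewrite foldr_map.
  apply: (lifts_foldr (F := F i j)) hp2 => k p3 P3 b3 d3 _ hp3.
  exact: lifts_mul (lifts_qfac i j k) hp3.
- congr (_ * _); rewrite big_enum; apply: eq_bigr => i _; rewrite /s big_filter big_enum_cond.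
  apply: eq_bigr => j _.
  by rewrite -[iota 0 M.+1]/(index_iota 0 M.+1) big_mkord.
(* Each variable is the denominator in [n] ordered pairs, [M.+1] times in each. *)
- congr (_ + _)%MM; apply/mnmP => t; rewrite mnm_sumE mnmE big_enum /=.
  rewrite (eq_bigr (fun i => \sum_(j < n.+1 | j != i) M.+1 * (j == t))%N) => [|i _].
    rewrite (exchange_big_dep xpredT) //= (bigD1 t) //= [X in (_ + X)%N]big1 => [|j /negPf ne].
      rewrite addn0 eqxx muln1 (eq_bigl (fun i => i != t)) => [|i]; last by rewrite eq_sym.
      by rewrite sum_nat_const cardC1 card_ord.
    by rewrite big1 // => i _; rewrite ne muln0.
  rewrite mnm_sumE /s big_filter big_enum_cond; apply: eq_bigr => j _.
  by rewrite /b1 mnm_sumE big_const_seq count_predT size_iota iter_addn_0 mnmE mulnC.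
- congr (_ + _)%N; rewrite big_enum /=.
  rewrite (eq_bigr (fun=> n * M.+1)%N) => [|i _]; first by rewrite sum_nat_const card_ord.
  rewrite /s big_filter big_enum_cond (eq_bigr (fun=> M.+1)) => [|j _].
    by rewrite sum_nat_const cardC1 card_ord.
  by rewrite /d1 sum1_size size_iota.
Qed.

Lemma lifts_qfact M :
  lifts (pprod [seq qfac (mono0 n) k | k <- iota 1 M]) ((qfact 'X M)%:MP : mpol) 0%MM 0.
Proof.
rewrite /pprod foldr_map.
apply: lifts_eq (lifts_foldr (F := fun k => (1 - 'X ^+ k)%:MP) (b := fun=> 0%MM) (d := fun=> 0%N)
   _ (lifts_one n)) _ _ _.
- by move=> k p P b d _; apply: lifts_mul; exact: lifts_qfac0.
- rewrite mulr1 -[iota 1 M]/(iota (1 + 0) M) iotaDl big_map.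
  rewrite /qfact rmorph_prod /= -(big_mkord xpredT (fun k => (1 - 'X ^+ k.+1)%:MP)).
  by rewrite /index_iota subn0.
- by rewrite big1_eq add0m.
- by rewrite big1_eq.
Qed.

Lemma lifts_nseq k p P p0 P0 b0 d0 : @lifts n p P 0%MM 0 -> lifts p0 P0 b0 d0 ->
  lifts (foldr (@pmul n) p0 (nseq k p)) (P ^+ k * P0) b0 d0.
Proof.
move=> hp hp0; elim: k => [|k IHk] /=; first by rewrite mul1r.
by rewrite exprS -mulrA -[b0]add0m -[d0]add0n; exact: lifts_mul.
Qed.

Lemma lifts_integrand (m : int) M :
  lifts (integrand_trunc n.+1 m M)
    ((qfact 'X M ^+ n)%:MP *
      (theta_prod ('X : {poly rat})%:MP M.+1 (fun i => 'X_i) *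
        \sum_(i < n.+1) 'X_[wilson_mnm m i]))
    [multinom (n * M.+1 + absz m)%N | i < n.+1]
    (n.+1 * (n * M.+1) + (n * absz m + absz (`|m| + m)%R)).
Proof.
rewrite /integrand_trunc /pprod !foldr_cat rmorphXn /=.
apply: lifts_nseq; first exact: lifts_qfact.
apply: lifts_eq (lifts_theta_prod M (lifts_mul (lifts_sum_power m) (lifts_one n))) _ _ _.
- by rewrite mulr1.
- by rewrite addm0; apply/mnmP => i; rewrite !mnmE.
- by rewrite addn0.
Qed.

End Integrand.

Lemma msym_sum_power n (m : int) (s : 'S_n.+1) :
  msym s (\sum_(i < n.+1) 'X_[wilson_mnm m i]) =
  \sum_(i < n.+1) 'X_[wilson_mnm m i] :> {mpoly {poly rat}[n.+1]}.
Proof.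
rewrite raddf_sum [RHS](reindex_inj (@perm_inj _ s)) /=; apply: eq_bigr => i _.
rewrite msymX; congr 'X_[_]; apply/mnmP => j; rewrite !mnmE.
by rewrite (canF_eq (permKV s)).
Qed.

(** Symmetrisation supplies the factorial; each of the summands then carries the same stable
    constant term, which [qfact 'X M ^+ n] turns into 1. *)
Lemma mcoeff_integrand n M (l : int) :
  let m := l * n.+1%:Z in
  eqmod ('X ^+ M.+1)
    (((qfact ('X : {poly rat}) M ^+ n)%:MP *
      (theta_prod ('X : {poly rat})%:MP M.+1 (fun i => 'X_i) *
        \sum_(i < n.+1) 'X_[wilson_mnm m i]))@_[multinom (n * M.+1 + absz (`|m| + l)%R)%N | i < n.+1])
    ((n.+1)`!%:R * \sum_(i < n.+1) (-1) ^+ (n * absz l) * 'X ^+ absz (shift_exp n l (n - i))).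
Proof.
move=> m; rewrite mcoeffCM mcoeff_theta_prod => [|s]; last exact: msym_sum_power.
rewrite mulrCA; apply: eqmodMl; rewrite mulr_sumr mulr_suml raddf_sum mulr_sumr /=.
apply: eqmod_sum => i _; apply: eqmod_trans (eqmodMl _ (@mcoeff_dyson_wilson n M l i)) _.
rewrite mulrCA -[X in eqmod _ _ X]mulr1; apply: eqmodMl; exact: dyson_ct_limit.
Qed.

Lemma shift_exp_ge0 n l i : (i <= n)%N -> 0 <= shift_exp n l i.
Proof.
move=> le; case: l => p; first by rewrite shift_exp_pos.
by rewrite NegzE shift_exp_neg.
Qed.

Theorem theorem1p2 (N : nat) (m : int) (M n : nat) :
  (2 <= N)%N -> (n <= M)%N -> wilson_coef N m M n = rhs_coef N m n.
Proof.
case: N => [//|k] _ le_nM; rewrite /wilson_coef /rhs_coef.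
have L := lifts_integrand k m M.
case: ifPn => [dvd_m|ndvd_m]; last first.
  (* The total degree of the lift is congruent to [m] modulo [k.+1]. *)
  rewrite (sum_lifts0 n L erefl) ?mulr0 //; apply: contra ndvd_m => dvd_d.
  have def_d : (k * absz m + absz (`|m| + m)%R)%N%:Z = k.+1%:Z * `|m| + m by lia.
  move: dvd_d; rewrite dvdn_addr ?dvdn_mulr // => dvd_d.
  have : (k.+1%:Z %| k.+1%:Z * `|m| + m)%Z by rewrite -def_d.
  by rewrite rpredDl ?dvdz_mulr.
set l := (m %/ k.+1%:Z)%Z; have def_m : m = l * k.+1%:Z by rewrite divzK.
(* Relative to the cleared denominator this is the coefficient of $(x_1 \cdots x_N)^l$; $|m|+l$ is
   nonnegative because $|l| \le |m|$. *)
rewrite (sum_lifts (a := (k * M.+1 + absz (`|m| + l)%R)%N) n L erefl); last first.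
  have le_lm : (absz l <= absz m)%N by rewrite def_m abszM leq_pmulr.
  have e1 : (absz (`|m| + l))%:Z = `|m| + l by lia.
  have e2 : (absz (`|m| + m))%:Z = `|m| + m by lia.
  apply/eqP; rewrite mulnDr eqn_add2l -eqz_nat PoszD !PoszM e1 e2 abszE.
  by move: `|m| => a; rewrite def_m -natz; apply/eqP; ring.
have := eqmod_coef (@mcoeff_integrand k M l) le_nM; rewrite -def_m => ->.
rewrite mulr_natl coefMn -[X in _ * X]mulr_natl mulKf ?pnatr_eq0 -?lt0n ?fact_gt0 //.
(* The exponents arose with [k - i] in place of [i], hence the reversal of the sum. *)
rewrite coef_sum mulr_sumr (reindex_inj rev_ord_inj) /=; apply: eq_bigr => i _.
have le_i : (i <= k)%N by rewrite -ltnS ltn_ord.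
have -> : (k - (k.+1 - i.+1))%N = i by rewrite subSS subKn.
have -> : (-1) ^+ (k * absz l) = ((-1) ^ (l * k%:Z) : rat)%:P :> {poly rat}.
  have -> : (-1) ^ (l * k%:Z) = (-1) ^+ (k * absz l) :> rat.
    case: l {def_m} => p; first by rewrite -PoszM -exprnP mulnC.
    by rewrite NegzE mulNr -PoszM -exprnN invr_sign mulnC abszN.
  by rewrite rmorphXn rmorphN1.
rewrite mul_polyC coefZ coefXn; congr (_ * (_ : bool)%:R).
rewrite -/(shift_exp k l i) -[shift_exp k l i]gez0_abs ?shift_exp_ge0 //.
by rewrite eq_sym.
Qed.
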